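(* Let $K$ be a field, $S=K[x_1,\ldots,x_n]$, and let $I\subset S$ be a monomial ideal which has linear quotients. Then for every vector $\mathfrak{c}\in\mathbb{N}^n$, the ideal $I_{\mathfrak{c}}$ has linear quotients.
   Context: $\mathbb{N}$ is the set of nonnegative integers. For $\mathfrak{c}=(c_1,\ldots,c_n)\in\mathbb{N}^n$, a monomial $x_1^{a_1}\cdots x_n^{a_n}$ is $\mathfrak{c}$-bounded if $a_i\leq c_i$ for all $i$. For a monomial ideal $I\subset S$, $I_{\mathfrak{c}}$ denotes the ideal generated by all $\mathfrak{c}$-bounded monomials belonging to $I$, and $\mathcal{G}(I)$ denotes the unique minimal set of monomial generators of $I$. A monomial ideal $I$ (not necessarily generated in a single degree) has linear quotients if the elements of $\mathcal{G}(I)$ can be ordered as $u_1,\ldots,u_m$ so that for each $1\leq i<m$ the colon ideal $(u_1,\ldots,u_i):u_{i+1}$ is generated by a subset of $\{x_1,\ldots,x_n\}$ (the zero ideal satisfies this vacuously). *)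

(* Defs.v *)
From HB Require Import structures.
From mathcomp Require Import all_boot all_order all_algebra.
From mathcomp Require Export mpoly.

Set Implicit Arguments.
Unset Strict Implicit.
Unset Printing Implicit Defensive.

Import GRing.Theory.
Local Open Scope ring_scope.

(* Subsets (in particular ideals) of S = K[x_1, ..., x_n] are predicates
   S -> Prop, since membership in an arbitrary one is not decidable; they are
   compared extensionally, through same_set.  Monomials are represented by their
   exponent vectors m : 'X_{1..n}, the monomial itself being 'X_[m]. *)

Definition same_set (T : Type) (A B : T -> Prop) : Prop :=
  forall x, A x <-> B x.

Definition generated_ideal (K : fieldType) (n : nat)
    (A : {mpoly K[n]} -> Prop) : {mpoly K[n]} -> Prop :=
  fun f => exists2 s : seq ({mpoly K[n]} * {mpoly K[n]}),
    forall p, p \in s -> A p.2 & f = \sum_(p <- s) p.1 * p.2.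

Definition monomials (K : fieldType) (n : nat)
    (M : 'X_{1..n} -> Prop) : {mpoly K[n]} -> Prop :=
  fun f => exists2 m, M m & f = 'X_[m].

Definition monomial_ideal (K : fieldType) (n : nat)
    (I : {mpoly K[n]} -> Prop) : Prop :=
  exists M : 'X_{1..n} -> Prop, same_set I (generated_ideal (monomials M)).

(* G is the set G(I): it generates I, and no proper subset of it does.  For a
   monomial ideal I there is exactly one such G. *)
Definition minimal_monomial_generators (K : fieldType) (n : nat)
    (I : {mpoly K[n]} -> Prop) (G : 'X_{1..n} -> Prop) : Prop :=
  same_set I (generated_ideal (monomials G)) /\
  forall H : 'X_{1..n} -> Prop,
    (forall m, H m -> G m) ->
    same_set I (generated_ideal (monomials H)) ->
    same_set H G.

Definition colon_ideal (K : fieldType) (n : nat)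
    (J : {mpoly K[n]} -> Prop) (u : {mpoly K[n]}) : {mpoly K[n]} -> Prop :=
  fun f => J (f * u).

Definition generated_by_variables (K : fieldType) (n : nat)
    (J : {mpoly K[n]} -> Prop) : Prop :=
  exists V : {set 'I_n},
    same_set J (generated_ideal (fun f => exists2 j, j \in V & f = 'X_j)).

(* The list u is 0-based: take i u consists of u_1, ..., u_i, and the entry of
   index i is u_(i+1). *)
Definition has_linear_quotients (K : fieldType) (n : nat)
    (I : {mpoly K[n]} -> Prop) : Prop :=
  exists u : seq 'X_{1..n},
    [/\ uniq u,
        minimal_monomial_generators I (fun m => m \in u)
      & forall i : nat, (1 <= i < size u)%N ->
          generated_by_variables
            (colon_ideal
               (generated_ideal (monomials (fun m => m \in take i u)))
               ('X_[nth 0%MM u i] : {mpoly K[n]}))].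

Definition bounded_monomial (n : nat) (c : 'I_n -> nat)
    (m : 'X_{1..n}) : Prop :=
  forall i : 'I_n, (m i <= c i)%N.

Definition bounded_ideal (K : fieldType) (n : nat) (c : 'I_n -> nat)
    (I : {mpoly K[n]} -> Prop) : {mpoly K[n]} -> Prop :=
  generated_ideal (monomials (fun m => bounded_monomial c m /\ I 'X_[m])).

(* Main.v *)
Require Import Defs.
From mathcomp Require Import all_boot all_order all_algebra.

(** A divisor of a [c]-bounded monomial is [c]-bounded, so [G(I_c)] is the set
    of [c]-bounded elements of [G(I)]; order it as in [G(I)].  Suppose [g]
    precedes [w], both bounded.  Linear quotients of [I] give a variable [x_l]
    dividing [g / gcd (g, w)] and an earlier [g'] dividing [x_l w].  Since
    [deg_l w < deg_l g <= c_l], the monomial [x_l w] is bounded, hence so is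
    [g'], and [x_l] lies in the corresponding colon ideal of [I_c]. *)

Set Implicit Arguments.
Unset Strict Implicit.
Unset Printing Implicit Defensive.

Import GRing.Theory.

(** Every monomial in the support of a multiple of ['X_[g]] is divisible by ['X_[g]]; conversely [f]
    is the sum of its terms. Ideal membership thus becomes divisibility of exponent vectors. *)
Lemma generated_ideal_monomialsP (K : fieldType) (n : nat)
    (M : 'X_{1..n} -> Prop) (f : {mpoly K[n]}) :
  generated_ideal (monomials M) f <->
  forall m, m \in msupp f -> exists2 g, M g & (g <= m)%MM.
Proof.
split.
  case=> s sM -> m /msupp_sum_le /flattenP[_ /mapP[p + ->]].
  rewrite mem_filter /= => ps.
  have [g Mg ->] := sM _ ps.
  rewrite (perm_mem (msuppMX _ _)) => /mapP[k _ ->].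
  by exists g => //; apply/mnm_lepP => i; rewrite mnmDE leq_addr.
move=> fM; rewrite (mpolyE f).
have: forall m, m \in msupp f -> exists2 g, M g & (g <= m)%MM by [].
elim: (msupp f) => [|m s IHs] sM.
  by exists [::] => //; rewrite !big_nil.
have [|t tM tE] := IHs; first by move=> k ks; apply: sM; rewrite inE ks orbT.
have [|g Mg gm] := sM m; first by rewrite mem_head.
exists ((f@_m *: 'X_[(m - g)%MM], 'X_[g])%R :: t) => [p|].
  by rewrite inE => /orP[/eqP->|/tM//]; exists g.
by rewrite !big_cons tE /= -scalerAl -mpolyXD submK.
Qed.

Lemma generated_ideal_monomialsXP (K : fieldType) (n : nat)
    (M : 'X_{1..n} -> Prop) (m : 'X_{1..n}) :
  generated_ideal (monomials M) ('X_[m] : {mpoly K[n]})%R <->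
  exists2 g, M g & (g <= m)%MM.
Proof.
rewrite generated_ideal_monomialsP; split=> [|gm k]; first apply.
  by rewrite msuppX mem_head.
by rewrite msuppX inE => /eqP->.
Qed.

(** Multiplication by ['X_[w]] translates the support by [w]. *)
Lemma colon_ideal_monomialP (K : fieldType) (n : nat)
    (M : 'X_{1..n} -> Prop) (w : 'X_{1..n}) (f : {mpoly K[n]}) :
  colon_ideal (generated_ideal (monomials M)) 'X_[w]%R f <->
  forall m, m \in msupp f -> exists2 g, M g & (g <= w + m)%MM.
Proof.
rewrite /colon_ideal generated_ideal_monomialsP.
split=> fM m.
  by move=> mf; apply: fM; rewrite (perm_mem (msuppMX _ _)) map_f.
by rewrite (perm_mem (msuppMX _ _)) => /mapP[k kf ->]; apply: fM.
Qed.

Lemma generated_ideal_variablesP (K : fieldType) (n : nat) (V : {set 'I_n})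
    (f : {mpoly K[n]}) :
  generated_ideal (fun h : {mpoly K[n]} => exists2 j, j \in V & h = 'X_j)%R f <->
  forall m, m \in msupp f -> exists2 j, j \in V & 0 < m j.
Proof.
have -> : generated_ideal
    (fun h : {mpoly K[n]} => exists2 j, j \in V & h = 'X_j)%R f <->
    generated_ideal (monomials (fun m => exists2 j, j \in V & m = U_(j)%MM)) f.
  split=> -[s sV ->]; exists s => // p /sV.
    by case=> j Vj ->; exists U_(j)%MM => //; exists j.
  by case=> _ [j Vj ->] ->; exists j.
rewrite generated_ideal_monomialsP; split=> fV m /fV.
  case=> _ [j Vj ->] /mnm_lepP/(_ j); rewrite mnm1E eqxx => mj.
  by exists j.
case=> j Vj mj; exists U_(j)%MM; first by exists j.
by apply/mnm_lepP => i; rewrite mnm1E; case: eqP => // <-.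
Qed.

(** Membership in either ideal is tested monomial by monomial, so comparing them on single monomials
    is enough. *)
Lemma colon_generated_by_variablesP (K : fieldType) (n : nat)
    (M : 'X_{1..n} -> Prop) (w : 'X_{1..n}) :
  generated_by_variables
    (colon_ideal (generated_ideal (monomials M)) ('X_[w] : {mpoly K[n]})%R) <->
  exists V : {set 'I_n}, forall m,
    (exists2 g, M g & (g <= w + m)%MM) <-> (exists2 j, j \in V & 0 < m j).
Proof.
split=> -[V VE]; exists V.
  move=> m; have := VE 'X_[m]%R.
  rewrite colon_ideal_monomialP generated_ideal_variablesP => -[MV VM].
  have mm : m \in msupp ('X_[m] : {mpoly K[n]})%R by rewrite msuppX mem_head.
  by split=> mP; [apply: MV mm | apply: VM mm] => k;
    rewrite msuppX inE => /eqP->.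
move=> f; rewrite colon_ideal_monomialP generated_ideal_variablesP.
by split=> fP m /fP /VE.
Qed.

Lemma minimal_monomial_generatorsP (K : fieldType) (n : nat)
    (I : {mpoly K[n]} -> Prop) (G : 'X_{1..n} -> Prop) :
  minimal_monomial_generators I G <->
  same_set I (generated_ideal (monomials G)) /\
  (forall g h, G g -> G h -> (g <= h)%MM -> g = h).
Proof.
split=> -[IG Gmin]; split=> //.
  move=> g h Gg Gh gh; case: (eqVneq g h) => // /eqP neq_gh.
  pose H m := G m /\ m <> h.
  case: (Gmin H _ _ h) => [m []//||_ /(_ Gh) []//].
  move=> f; split=> [/IG|] /generated_ideal_monomialsP fG.
    apply/generated_ideal_monomialsP => m /fG[k Gk km].
    case: (eqVneq k h) => [kh|/eqP neq_kh]; last by exists k.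
    by exists g => //; apply: lepm_trans gh _; rewrite -kh.
  by apply/IG/generated_ideal_monomialsP => m /fG[k [Gk _] km]; exists k.
move=> H HG IH m; split=> [/HG//|Gm].
have /IH/generated_ideal_monomialsXP[h Hh hm] : I 'X_[m]%R.
  by apply/IG/generated_ideal_monomialsXP; exists m => //; exact: lepm_refl.
by rewrite -(Gmin _ _ (HG _ Hh) Gm hm).
Qed.

(** Identifies the generators of [I_c] preceding [x] with the bounded ones among those preceding [x]
    in the order for [I]. *)
Lemma take_index_filter (T : eqType) (P : pred T) (s : seq T) (x : T) :
  P x -> take (index x (filter P s)) (filter P s) = filter P (take (index x s) s).
Proof.
move=> Px; elim: s => //= y s IHs; case: (eqVneq y x) => [->|neq_yx].
  by rewrite Px /= eqxx.
by case Py: (P y); rewrite /= ?Py ?(negPf neq_yx) /= IHs.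
Qed.

Definition boundedb (n : nat) (c : 'I_n -> nat) (m : 'X_{1..n}) : bool :=
  [forall i, m i <= c i].

Lemma boundedP (n : nat) (c : 'I_n -> nat) (m : 'X_{1..n}) :
  reflect (bounded_monomial c m) (boundedb c m).
Proof. exact: forallP. Qed.

Lemma bounded_monomial_le (n : nat) (c : 'I_n -> nat) (g m : 'X_{1..n}) :
  (g <= m)%MM -> bounded_monomial c m -> bounded_monomial c g.
Proof. by move=> /mnm_lepP gm mc i; apply: leq_trans (gm i) (mc i). Qed.

Lemma bounded_minimal_generators (K : fieldType) (n : nat) (c : 'I_n -> nat)
    (I : {mpoly K[n]} -> Prop) (u : seq 'X_{1..n}) :
  minimal_monomial_generators I (fun m => m \in u) ->
  minimal_monomial_generators (bounded_ideal c I)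
    (fun m => m \in filter (boundedb c) u).
Proof.
move=> /minimal_monomial_generatorsP[Iu u_anti].
apply/minimal_monomial_generatorsP; split; last first.
  by move=> g h; rewrite !mem_filter => /andP[_ gu] /andP[_ hu]; apply: u_anti.
move=> f; rewrite [bounded_ideal c I f]generated_ideal_monomialsP.
rewrite generated_ideal_monomialsP; split=> fP m /fP.
  case=> k [kc /Iu/generated_ideal_monomialsXP[g gu gk] km].
  exists g; last exact: lepm_trans gk km.
  by rewrite mem_filter gu andbT; apply/boundedP/(bounded_monomial_le gk).
case=> g; rewrite mem_filter => /andP[/boundedP gc gu] gm.
exists g => //; split=> //; apply/Iu/generated_ideal_monomialsXP.
by exists g => //; exact: lepm_refl.
Qed.

Lemma bounded_colon_generated_by_variables (K : fieldType) (n : nat)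
    (c : 'I_n -> nat) (s : seq 'X_{1..n}) (w : 'X_{1..n}) :
  bounded_monomial c w ->
  generated_by_variables
    (colon_ideal (generated_ideal (monomials (fun m => m \in s)))
       ('X_[w] : {mpoly K[n]})%R) ->
  generated_by_variables
    (colon_ideal
       (generated_ideal (monomials (fun m => m \in filter (boundedb c) s)))
       ('X_[w] : {mpoly K[n]})%R).
Proof.
move=> wc /colon_generated_by_variablesP[V VE].
apply/colon_generated_by_variablesP.
(* The set [V] may be too large, as an element of [s] dividing [x_l w] need not be bounded; only the
   variables already in the new colon ideal are kept. *)
exists [set l | has (fun g => (g <= w + U_(l))%MM) (filter (boundedb c) s)].
move=> m; split=> [[g]|[l]].
  rewrite mem_filter => /andP[/boundedP gc gs] /mnm_lepP gwm.
  (* Subtraction is truncated, so [g - w] is the exponent of [g / gcd (g, w)]. *)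
  have [|l Vl] := (VE (g - w)%MM).1.
    by exists g => //; apply/mnm_lepP => i; rewrite mnmDE mnmBE -leq_subLR.
  rewrite mnmBE subn_gt0 => wg.
  have [|g' g's g'w] := (VE U_(l)%MM).2; first by exists l; rewrite // mnm1E eqxx.
  (* Here [w l < g l <= w l + m l], whence [0 < m l]. *)
  exists l; last by rewrite -(ltn_add2l (w l)) addn0 -mnmDE (leq_trans wg).
  rewrite inE; apply/hasP; exists g' => //; rewrite mem_filter g's andbT.
  apply/boundedP/(bounded_monomial_le g'w) => i; rewrite mnmDE mnm1E.
  case: eqP => [<-|_]; last by rewrite addn0.
  by rewrite addn1 (leq_trans wg).
rewrite inE => /hasP[g gs /mnm_lepP gw] ml; exists g => //.
apply/mnm_lepP => i; apply: leq_trans (gw i) _.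
by rewrite !mnmDE leq_add2l mnm1E; case: eqP => // <-.
Qed.

Theorem proposition3p1 (K : fieldType) (n : nat) (I : {mpoly K[n]} -> Prop)
    (hI : monomial_ideal I) (hlin : has_linear_quotients I) :
  forall c : 'I_n -> nat, has_linear_quotients (bounded_ideal c I).
Proof.
move=> c; have [u [u_uniq u_gen u_lin]] := hlin.
exists (filter (boundedb c) u); split.
- exact: filter_uniq.
- exact: bounded_minimal_generators.
move=> i /andP[i_gt0 i_lt].
set w := nth _ _ i.
have : w \in filter (boundedb c) u by apply: mem_nth.
rewrite mem_filter => /andP[wc wu].
have takeE : take i (filter (boundedb c) u) =
    filter (boundedb c) (take (index w u) u).
  by rewrite -take_index_filter // index_uniq // filter_uniq.
rewrite takeE; apply: bounded_colon_generated_by_variables; first exact/boundedP.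
rewrite -{2}(nth_index 0%MM wu); apply: u_lin; rewrite index_mem wu andbT.
(* The hypothesis on [u] covers positive indices only. Were [w] first in [u], no bounded generator
   would precede it, contradicting [0 < i]. *)
case: (index w u) takeE => // /(congr1 size).
by rewrite take0 size_take i_lt => i0; rewrite i0 in i_gt0.
Qed.
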